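(* Let $n\ge 1$ be an integer, and let $p,\alpha,\lambda$ be real numbers such that either ($p>1$ and $0<\alpha<\frac{n+2}{2p}$) or ($p=1$ and $0<\alpha\le\frac{n+2}{2p}$), and such that $0<\lambda<1$. Suppose $u\in Y^p_\alpha$ satisfies $$0\le(\partial_t-\Delta)^\alpha u\le u^\lambda\quad\text{in }\mathbb{R}^n\times\mathbb{R},\qquad u=0\quad\text{in }\mathbb{R}^n\times(-\infty,0).$$ Then for all $T>0$ we have $$\|u\|_{L^\infty(\mathbb{R}^n\times(0,T))}\le(MT^\alpha)^{\frac{1}{1-\lambda}}$$ and $$\|(\partial_t-\Delta)^\alpha u\|_{L^\infty(\mathbb{R}^n\times(0,T))}\le(MT^\alpha)^{\frac{\lambda}{1-\lambda}},$$ where $$M=M(\alpha,\lambda)=\frac{\Gamma\left(\frac{\alpha\lambda}{1-\lambda}+1\right)}{\Gamma\left(\alpha+\frac{\alpha\lambda}{1-\lambda}+1\right)}$$ and $\Gamma$ is the Gamma function.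
   Context: For $\alpha>0$ and $(x,t)\in\mathbb{R}^n\times\mathbb{R}$ let $$\Phi_\alpha(x,t)=\frac{t^{\alpha-1}}{\Gamma(\alpha)}\frac{1}{(4\pi t)^{n/2}}e^{-|x|^2/(4t)}\chi_{(0,\infty)}(t)$$ and $$J_\alpha f(x,t)=\iint_{\mathbb{R}^n\times(-\infty,t)}\Phi_\alpha(x-\xi,t-\tau)f(\xi,\tau)\,d\xi\,d\tau .$$ For $T\in\mathbb{R}$ put $\mathbb{R}_T=(-\infty,T)$. $X^p=\bigcap_{T\in\mathbb{R}}L^p(\mathbb{R}^n\times\mathbb{R}_T)$ is the set of all measurable $f:\mathbb{R}^n\times\mathbb{R}\to\mathbb{R}$ with $\|f\|_{L^p(\mathbb{R}^n\times\mathbb{R}_T)}<\infty$ for all $T\in\mathbb{R}$, and $Y^p_\alpha=J_\alpha(X^p)$. Functions equal almost everywhere are identified, and (in)equalities between elements of these spaces are understood almost everywhere. When ($p>1$ and $0<\alpha<\frac{n+2}{2p}$) or ($p=1$ and $0<\alpha\le\frac{n+2}{2p}$), the integral defining $J_\alpha f$ yields a real-valued measurable function for each $f\in X^p$, the operator $J_\alpha:X^p\to Y^p_\alpha$ is one-to-one and onto, and $(\partial_t-\Delta)^\alpha:Y^p_\alpha\to X^p$ is defined to be its inverse. Since $(\partial_t-\Delta)^\alpha u\ge0$ forces $u\ge0$, the power $u^\lambda$ is meaningful. *)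

(* Defs.v *)
From HB Require Import structures.
From mathcomp Require Import all_boot all_order all_algebra.
From mathcomp Require Import all_classical all_reals all_analysis.

Set Implicit Arguments.
Unset Strict Implicit.
Unset Printing Implicit Defensive.

Import Order.TTheory GRing.Theory Num.Theory.
Import numFieldNormedType.Exports.

Local Open Scope classical_set_scope.
Local Open Scope ring_scope.

(* R^n is [n.-tuple R] with its product Borel sigma-algebra. *)
Notation spacetime R n := (n.-tuple R * measurableTypeR R)%type.

Section lebesgue_tuple.
Context {R : realType}.

Definition tuple_of_pair n (z : measurableTypeR R * n.-tuple R) :
  n.+1.-tuple R := [tuple of z.1 :: z.2].

Lemma measurable_tuple_of_pair n :
  measurable_fun [set: measurableTypeR R * n.-tuple R] (@tuple_of_pair n).
Proof. exact: measurable_cons. Qed.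

Section step.
Context n (m : {measure set (n.-tuple R) -> \bar R}).

(* \x^ (rather than \x) only asks its first factor to be sigma-finite. *)
Definition lebesgue_tuple_step : set (n.+1.-tuple R) -> \bar R :=
  pushforward (lebesgue_measure \x^ m)%E (@tuple_of_pair n).

Let step0 : lebesgue_tuple_step set0 = 0%E.
Proof. by rewrite /lebesgue_tuple_step /pushforward preimage_set0 measure0. Qed.

Let step_ge0 A : (0 <= lebesgue_tuple_step A)%E.
Proof. exact: (measure_ge0 (lebesgue_measure \x^ m)%E). Qed.

Let step_sigma_additive : semi_sigma_additive lebesgue_tuple_step.
Proof.
have mcons A : measurable A -> measurable (@tuple_of_pair n @^-1` A).
  by move=> mA; rewrite -[X in measurable X]setTI; exact: measurable_tuple_of_pair.
move=> F mF tF mUF; rewrite /lebesgue_tuple_step /pushforward preimage_bigcup.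
apply: (@measure_semi_sigma_additive _ _ _ (lebesgue_measure \x^ m)%E).
- by move=> k; exact: mcons.
- apply/trivIsetP => i j _ _ ij; rewrite -preimage_setI.
  by move/trivIsetP : tF => /(_ _ _ _ _ ij) ->//; rewrite preimage_set0.
- by rewrite -preimage_bigcup; exact: mcons.
Qed.

HB.instance Definition _ := isMeasure.Build _ _ _ lebesgue_tuple_step
  step0 step_ge0 step_sigma_additive.

End step.

(* n-dimensional Lebesgue measure *)
Fixpoint lebesgue_tuple n : {measure set (n.-tuple R) -> \bar R} :=
  match n with
  | 0 => \d_([tuple] : 0.-tuple R)
  | m.+1 => lebesgue_tuple_step (lebesgue_tuple m)
  end.

End lebesgue_tuple.

Section spacetime.
Context {R : realType} {n : nat}.
Local Notation S := (spacetime R n).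
Implicit Types (f u : S -> R) (z w : S) (x : n.-tuple R) (p a T t : R).

Definition lebesgue_spacetime : set S -> \bar R :=
  (lebesgue_tuple n \x lebesgue_measure)%E.

HB.instance Definition _ := Measure.on lebesgue_spacetime.

Local Notation mu := lebesgue_spacetime.

(* The norm in L^q(D), through extension by zero outside D (as in
   [\int[mu]_(z in D) _]). *)
Definition Lnorm_on (q : \bar R) (D : set S) f : \bar R :=
  'N[mu]_q [(EFin \o f) \_ D].

Definition Gamma a : R :=
  (\int[lebesgue_measure]_(s in `]0%R, +oo[) (s `^ (a - 1) * expR (- s)))%R.

Definition sqnorm x : R := \sum_(i < n) tnth x i ^+ 2.

Definition subt x y : n.-tuple R := [tuple tnth x i - tnth y i | i < n].

Definition Phi a x t : R :=
  if 0 < t then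
    t `^ (a - 1) / Gamma a * ((4 * pi * t) `^ (n%:R / 2))^-1
    * expR (- (sqnorm x / (4 * t)))
  else 0.

(* Extended-real valued, because the integral need not converge at every z:
   [J a f z] is finite exactly when the integrand is integrable. *)
Definition J a f z : \bar R :=
  (\int[mu]_(w in [set w | (w.2 < z.2)%R])
     (Phi a (subt z.1 w.1) (z.2 - w.2) * f w)%:E)%E.

Definition X p : set (S -> R) :=
  [set f | measurable_fun [set: S] f /\
    forall T, (Lnorm_on p%:E [set z | (z.2 < T)%R] f < +oo)%E].

Definition J_eq a f u : Prop := \forall z \ae mu, J a f z = (u z)%:E.

Definition Y p a : set (S -> R) := [set u | exists2 f, X p f & J_eq a f u].

(* (d/dt - Laplacian)^a : Y p a -> X p, the inverse of J a.  As functions equal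
   almost everywhere are identified, a representative of the preimage is
   chosen; J a being one-to-one, any two of them agree almost everywhere. *)
Definition heat_power p a u : S -> R :=
  xget (cst 0) [set f | X p f /\ J_eq a f u].

End spacetime.

(* Main.v *)
From HB Require Import structures.
Require Import Defs.
From mathcomp Require Import all_boot all_order all_algebra.
From mathcomp Require Import all_classical all_reals all_analysis.
From mathcomp Require Import measurable_realfun ess_sup_inf.
From mathcomp Require Import ring lra.
Import Order.TTheory GRing.Theory Num.Theory.
Import numFieldNormedType.Exports.
Local Open Scope classical_set_scope.
Local Open Scope ring_scope.

(** Put [f] for the fractional heat power of [u], so that [u = J f] and
    [0 <= f <= u ^ lambda], both functions vanishing in the past.  The function
    [w t = (M * t ^ alpha) ^ (1 / (1 - lambda))] solves the corresponding
    equation [w = I (w ^ lambda)], where [I] is the fractional integral of order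
    [alpha] in time: this is Euler's beta integral
    ([integral_pospow_convolution]), and it is what determines [M].  As the heat
    kernel has unit mass in space, [w] is also a solution in space-time, and the
    theorem says that the subsolution [u] stays below it.

    To compare them, start [w] at time [- e] instead of [0], so that it is
    positive on the slab [0 <= t < T], and divide: [v = u / w] is obtained from
    [g = f / w ^ lambda], which is at most [v ^ lambda], by the kernel
    [k (z, y) = Phi (z - y) * w y ^ lambda / w z].  Each row of [k] has mass [1],
    because [w] is a solution; each column has mass at most a constant [C].
    Jensen's inequality therefore gives, for every [q >= 1],

      [\int v ^ q <= C * \int g ^ q <= C * \int v ^ (lambda * q)].

    Starting from the finite integral of [g ^ p] and dividing the exponent by
    [lambda] repeatedly, [\int v ^ (p / lambda ^ j) <= C ^ (j + 1) * \int g ^ p]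
    for all [j].  The right side grows exponentially in [j], whereas on a set
    where [v >= 1 + d] the left side grows doubly exponentially; hence [v <= 1]
    almost everywhere ([sublinear_kernel_op_le1]).  This gives boundedness and
    the sharp constant at the same time, without smoothing estimates.  Letting
    [e] tend to [0] bounds [u] by [w T], and then [f <= u ^ lambda] by
    [w T ^ lambda]. *)

(** * Powers, the Gamma function and the beta integral on the line *)

Section realline.
Context {R : realType}.
Local Notation leb := (@lebesgue_measure R).
Implicit Types (a b c d s t : R).

Lemma measurable_affine c d :
  measurable_fun setT (fun x : measurableTypeR R => c * x + d : measurableTypeR R).
Proof. by apply: measurable_funD => //; exact: measurable_funM. Qed.

(** Lebesgue measure is determined by its values on intervals, which an affine
    map scales by [c]. *)
Lemma ge0_integral_affine c d (f : measurableTypeR R -> \bar R) : 0 < c ->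
  measurable_fun setT f -> (forall x, (0 <= f x)%E) ->
  (\int[leb]_x f x = c%:E * \int[leb]_x f (c * x + d)%R)%E.
Proof.
move=> c0 mf f0.
pose phi (x : measurableTypeR R) : measurableTypeR R := c * x + d.
have mphi : measurable_fun setT phi := measurable_affine c d.
pose cn : {nonneg R} := NngNum (ltW c0).
pose m0 : {measure set (measurableTypeR R) -> \bar R} :=
  mscale cn (pushforward leb phi).
pose m := m0 mphi.
rewrite (eq_measure_integral m); last first.
  move=> A mA _.
  apply: (@lebesgue_measure_unique R m _ A mA).
  move=> _ [[u v]] _ <-.
  change (leb `]u, v] = c%:E * leb (phi @^-1` `]u, v]))%E.
  rewrite (_ : phi @^-1` _ = `](u - d) / c, (v - d) / c]%classic); last first.
    apply/seteqP; split => x /=; rewrite !in_itv/= ltr_pdivrMr// ler_pdivlMr//;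
    by rewrite ltrBlDr lerBrDr mulrC.
  rewrite !lebesgue_measure_itv/= !lte_fin ltr_pM2r ?invr_gt0// ltrD2r.
  case: ifP => _; last by rewrite mule0.
  rewrite -!EFinD -EFinM; congr (_%:E); field; exact: lt0r_neq0.
rewrite ge0_integral_mscale//; congr (_ * _)%E.
rewrite (@ge0_integral_pushforward _ _ _ _ _ phi)//.
Qed.

(** The power [s ^ b] of the positive part of the line, extended by zero, so
    that one-dimensional integrals can be taken over the whole line, where
    Lebesgue measure is invariant. *)
Definition pospow b s : R := if 0 < s then s `^ b else 0.

Lemma pospow_ge0 b s : 0 <= pospow b s.
Proof. by rewrite /pospow; case: ifP => // _; exact: powR_ge0. Qed.

Lemma measurable_pospow b : measurable_fun [set: R] (pospow b).
Proof.
by apply: measurable_fun_ifT => //; exact: measurable_fun_ltr.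
Qed.

Lemma pospowZ b c s : 0 < c -> pospow b (c * s) = c `^ b * pospow b s.
Proof.
move=> c0; rewrite /pospow pmulr_rgt0//; case: ifPn => s0; last by rewrite mulr0.
by rewrite powRM// ltW.
Qed.

Lemma continuous_powR b (x : R) : 0 < x -> {for x, continuous (fun s => s `^ b)}.
Proof.
move=> x0; apply/differentiable_continuous/derivable1_diffP.
by apply: derivable_powR; rewrite in_itv/= x0.
Qed.

(** The primitive [a^-1 * s ^ a] bounds by [a^-1] the integrals over the
    intervals [1 / (k + 2), 1], away from the singularity at [0]. *)
Lemma integral_powR_01_lt_pinfty a : 0 < a ->
  (\int[leb]_(s in `]0%R, 1%R]) (s `^ (a - 1))%:E < +oo)%E.
Proof.
move=> a0.
pose F (k : nat) : set (measurableTypeR R) := `[k.+2%:R^-1, 1]%classic.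
have FE : \bigcup_k F k = `]0%R, 1%R]%classic.
  apply/seteqP; split => [x [k _]|x]/=; rewrite /F/= !in_itv/=.
    by case/andP => kx ->; rewrite andbT (lt_le_trans _ kx)// invr_gt0.
  case/andP => x0 x1; exists (Num.truncn x^-1) => //; rewrite /= in_itv/= x1 andbT.
  rewrite -[leRHS]invrK lef_pV2 ?posrE// ?invr_gt0//.
  have := truncnS_gt x^-1; move/ltW/le_trans; apply; rewrite ler_nat//.
have ndF : nondecreasing_seq F.
  apply/nondecreasing_seqP => k; rewrite subsetEset => x; rewrite /F/= !in_itv/=.
  case/andP => kx ->; rewrite andbT (le_trans _ kx)// lef_pV2 ?posrE// ler_nat//.
have h : (\int[leb]_(s in F k) (s `^ (a - 1))%:E @[k --> \oo] -->
    \int[leb]_(s in \bigcup_k F k) (s `^ (a - 1))%:E)%E.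
  apply: ge0_nondecreasing_set_cvg_integral => //.
  + by move=> k; exact: measurable_itv.
  + move=> k; apply/measurable_EFinP; apply: measurable_funTS; exact: measurable_powR.
  + by move=> k x _; rewrite lee_fin powR_ge0.
rewrite -FE; apply: le_lt_trans (ltry a^-1).
rewrite -(cvg_lim _ h)//; apply: lime_le; first by apply/cvg_ex; eexists; exact: h.
apply: nearW => k.
have k1 : k.+2%:R^-1 < 1 :> R by rewrite invf_lt1// ltr1n.
have k0 : 0 < k.+2%:R^-1 :> R by rewrite invr_gt0.
pose G s := a^-1 * s `^ a.
have dG (x : R) : 0 < x -> is_derive x 1 G (x `^ (a - 1)).
  move=> x0; have -> : x `^ (a-1) = a^-1 *: (a * x `^ (a - 1)).
    by rewrite /GRing.scale/= mulrA mulVf ?mul1r// gt_eqF.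
  by have ? := is_derive1_powR a x0; rewrite /G; exact: is_deriveZ.
have cG' (x : R) : 0 < x -> {for x, continuous G}.
  move=> x0; apply/differentiable_continuous/derivable1_diffP.
  by have [] := dG _ x0.
rewrite (@continuous_FTC2 _ _ G)//.
- rewrite /G powR1 mulr1 lee_fin gerBl//.
  by rewrite mulr_ge0// ?powR_ge0// invr_ge0 ltW.
- apply: continuous_in_subspaceT => x; rewrite inE/= in_itv/= => /andP[kx _].
  by apply: continuous_powR; exact: lt_le_trans kx.
- split.
  + move=> x; rewrite in_itv/= => /andP[kx _].
    by have [] := dG x (lt_trans k0 kx).
  + by apply: cvg_at_right_filter; exact: cG'.
  + by apply: cvg_at_left_filter; exact: cG'.
- move=> x; rewrite in_itv/= => /andP[kx _].
  have := dG x (lt_trans k0 kx) => ?; by rewrite derive1E derive_val.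
Qed.

Lemma ge0_integral_translate d (f : measurableTypeR R -> \bar R) :
  measurable_fun setT f -> (forall x, (0 <= f x)%E) ->
  (\int[leb]_x f (x - d)%R = \int[leb]_x f x)%E.
Proof.
move=> mf f0; rewrite [RHS](@ge0_integral_affine 1 (- d))// mul1e.
by apply: eq_integral => x _; rewrite mul1r.
Qed.

Lemma measurable_gamma_density a :
  measurable_fun [set: R] (fun s => pospow (a - 1) s * expR (- s)).
Proof.
apply: measurable_funM; first exact: measurable_pospow.
by apply: measurableT_comp => //; exact: measurable_funN.
Qed.

(** Near [0] the density is dominated by the power.  Beyond [1] it is dominated
    by a multiple of the exponential density of rate [1 / 2]: the inequality
    [s / (2 * a) <= expR (s / (2 * a))], raised to the power [a], absorbs
    [s ^ (a - 1)] into [expR (s / 2)]. *)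
Lemma gamma_density_lt_pinfty a : 0 < a ->
  (\int[leb]_s (pospow (a - 1) s * expR (- s))%:E < +oo)%E.
Proof.
move=> a0; have h2 : 0 <= 2^-1 :> R by [].
pose C : R := 2 * (2 * a) `^ a.
have C0 : 0 <= C by rewrite mulr_ge0// powR_ge0.
pose near0 : measurableTypeR R -> \bar R :=
  (fun s => (s `^ (a - 1))%:E) \_ `]0%R, 1%R]%classic.
pose tail (s : measurableTypeR R) := (C%:E * (exponential_pdf 2^-1 s)%:E)%E.
have mnear0 : measurable_fun setT near0.
  apply/(measurable_restrictT _ _).1; first exact: measurable_itv.
  by apply/measurable_EFinP/measurable_funTS; exact: measurable_powR.
have mtail : measurable_fun setT tail.
  apply/measurable_EFinP; apply: measurable_funM => //.
  exact: measurable_exponential_pdf.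
have near00 s : (0 <= near0 s)%E.
  by apply: erestrict_ge0 => x _; rewrite lee_fin powR_ge0.
have tail0 s : (0 <= tail s)%E.
  by rewrite mule_ge0// lee_fin// exponential_pdf_ge0.
apply: (@le_lt_trans _ _ (\int[leb]_s (near0 s + tail s))%E); last first.
  rewrite ge0_integralD//; apply: lte_add_pinfty.
    by rewrite /near0 -integral_mkcond; exact: integral_powR_01_lt_pinfty.
  rewrite ge0_integralZl//; last 2 first.
  - by apply/measurable_EFinP; exact: measurable_exponential_pdf.
  - by move=> x _; rewrite lee_fin exponential_pdf_ge0.
  by rewrite integral_exponential_pdf ?invr_gt0// mule1 ltry.
apply: ge0_le_integral => //.
- by move=> s _; rewrite lee_fin mulr_ge0 ?expR_ge0// pospow_ge0.
- by apply/measurable_EFinP; exact: measurable_gamma_density.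
- exact: emeasurable_funD.
move=> s _; rewrite /pospow; case: ifPn => [s0|_]; last first.
  by rewrite mul0r adde_ge0.
have [s1|s1] := leP s 1.
  rewrite -[leLHS]adde0; apply: leeD => //.
  rewrite /near0 patchE mem_set ?lee_fin; last by rewrite /= in_itv/= s0 s1.
  by rewrite ler_piMr ?powR_ge0// -expR0 ler_expR oppr_le0 ltW.
rewrite -[leLHS]add0e; apply: leeD => //.
rewrite /tail /exponential_pdf patchE mem_set; last first.
  by rewrite /= in_itv/= ltW.
rewrite lee_fin /C.
have sa : s `^ (a - 1) <= (2 * a) `^ a * expR (s / 2).
  apply: (@le_trans _ _ (s `^ a)); first by apply: ler_powR; [exact: ltW|lra].
  have a2 : 2 * a != 0 by lra.
  have -> : s `^ a = (2 * a) `^ a * (s / (2 * a)) `^ a.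
    rewrite -powRM ?divr_ge0 ?mulr_ge0 ?ltW//; congr (_ `^ _).
    by rewrite mulrC divfK.
  rewrite ler_wpM2l ?powR_ge0//.
  have -> : expR (s / 2) = expR (s / (2 * a)) `^ a.
    rewrite -expRM; congr expR; field; exact: lt0r_neq0.
  have q0 : 0 <= s / (2 * a) by rewrite divr_ge0 ?mulr_ge0 ?ltW.
  rewrite ge0_ler_powR ?nnegrE ?expR_ge0 ?(ltW a0)//.
  by apply: le_trans (expR_ge1Dx _); rewrite lerDr.
have -> : 2 * (2 * a) `^ a * (2^-1 * expR (- 2^-1 * s)) =
    (2 * a) `^ a * expR (s / 2) * expR (- s).
  rewrite -(mulrA ((2 * a) `^ a)) -expRD.
  have -> : s / 2 - s = - 2^-1 * s by lra.
  by field.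
by rewrite ler_wpM2r// expR_ge0.
Qed.

Lemma Gamma_integral a : 0 < a ->
  (\int[leb]_s (pospow (a - 1) s * expR (- s))%:E = (Gamma a)%:E)%E.
Proof.
move=> a0; rewrite /Gamma /Rintegral.
rewrite [X in fine X](_ : _ =
    (\int[leb]_s (pospow (a - 1) s * expR (- s))%:E)%E); last first.
  rewrite integral_mkcond; apply: eq_integral => s _.
  rewrite patchE /pospow; case: ifPn => [|]; rewrite ?inE ?notin_setE/= in_itv/= andbT.
    by move=> ->.
  by move/negP/negbTE => ->; rewrite mul0r.
rewrite fineK// ge0_fin_numE ?gamma_density_lt_pinfty//.
by apply: integral_ge0 => s _; rewrite lee_fin mulr_ge0 ?expR_ge0// pospow_ge0.
Qed.

(** On [1, 2] the density is at least [s^-1 * expR (- s)], as [a - 1 >= - 1]. *)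
Lemma Gamma_gt0 a : 0 < a -> 0 < Gamma a.
Proof.
move=> a0; rewrite -lte_fin -Gamma_integral//.
apply: (@lt_le_trans _ _ (\int[leb]_(s in `]1%R, 2%R]) (2^-1 * expR (- 2))%:E)%E).
  rewrite integral_cst//= lebesgue_measure_itv/= lte_fin ltrDl ltr01 -EFinD -EFinM.
  by rewrite lte_fin mulr_gt0 ?mulr_gt0 ?expR_gt0// subr_gt0 ltrDl.
have m12 : measurable (`]1%R, 2%R]%classic : set (measurableTypeR R)).
  exact: measurable_itv.
apply: (@le_trans _ _ (\int[leb]_(s in `]1%R, 2%R]) (pospow (a - 1) s * expR (- s))%:E)%E).
- apply: ge0_le_integral => //.
  + apply/measurable_EFinP/measurable_funTS; exact: measurable_gamma_density.
  move=> s; rewrite /= in_itv/= => /andP[s1 s2].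
  have s0 : 0 < s by exact: lt_trans s1.
  rewrite lee_fin /pospow s0 ler_pM ?expR_ge0// ?ler_expR ?lerN2//.
  apply: (@le_trans _ _ (s `^ (-1))).
    by rewrite powR_inv1 ?(ltW s0)// lef_pV2 ?posrE.
  by apply: ler_powR; [exact: ltW|rewrite lerBrDr addNr ltW].
- apply: ge0_subset_integral => //.
  + by apply/measurable_EFinP; exact: measurable_gamma_density.
  + by move=> s _; rewrite lee_fin mulr_ge0 ?expR_ge0// pospow_ge0.
Qed.

Lemma measurable_frac_kernel a t :
  measurable_fun [set: R] (fun s => pospow a (t - s)).
Proof.
apply: (@measurableT_comp _ _ _ _ _ _ (pospow a)); first exact: measurable_pospow.
exact: measurable_funB.
Qed.

(** Euler's beta integral.  Scaling shows that the left side is [t ^ (a + b)]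
    times its value at [t = 1]; that value is found by integrating against
    [expR (- t)] and exchanging the integrals, which turns the convolution into
    the product of two Gamma integrals. *)
Lemma integral_pospow_convolution a b t : 0 < a -> -1 < b -> 0 < t ->
  (\int[leb]_s (pospow (a - 1) (t - s) * pospow b s)%:E =
   (t `^ (a + b) * (Gamma a * Gamma (b + 1) / Gamma (a + b + 1)))%:E)%E.
Proof.
move=> a0 b1 t0.
pose G y (s : measurableTypeR R) := (pospow (a - 1) (y - s) * pospow b s)%:E.
pose H x := (\int[leb]_s G x s)%E.
have G0 y s : (0 <= G y s)%E by rewrite lee_fin mulr_ge0 ?pospow_ge0.
have mH x : measurable_fun [set: R] (fun s => pospow (a - 1) (x - s) * pospow b s).
  by apply: measurable_funM; [exact: measurable_frac_kernel|exact: measurable_pospow].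
have mG y : measurable_fun [set: measurableTypeR R] (G y).
  by apply/measurable_EFinP; exact: mH.
have H0 x : (0 <= H x)%E by exact: integral_ge0.
have HZ x : 0 < x -> H x = ((x `^ (a + b))%:E * H 1%R)%E.
  move=> x0.
  rewrite [LHS](@ge0_integral_affine x 0 (G x) x0 (mG x) (G0 x)).
  rewrite -(@ge0_integralZl_EFin _ _ _ leb _ measurableT (fun s => G x (x * s + 0)))//; last 2 first.
  - exact: (measurableT_comp (mG x) (measurable_affine x 0)).
  - exact: ltW.
  have <- : (\int[leb]_s ((x `^ (a + b))%:E * G 1%R s) =
      (x `^ (a + b))%:E * H 1%R)%E by rewrite ge0_integralZl_EFin// powR_ge0.
  apply: eq_integral => s _; rewrite /G -!EFinM addr0; congr (_%:E).
  have -> : x - x * s = x * (1 - s) by ring.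
  rewrite !pospowZ//.
  have -> : x `^ (a + b) = x * (x `^ (a - 1) * x `^ b).
    rewrite -{2}(@powRr1 _ x) ?ltW// -!powRD ?(gt_eqF x0) ?implybT//.
    by congr (_ `^ _); ring.
  by ring.
have HN x : x <= 0 -> H x = 0%E.
  move=> x0; rewrite /H integral0_eq// => s _; rewrite /G /pospow subr_gt0.
  by case: ifPn => // sx; rewrite ?mul0r// ltNge (le_trans (ltW sx) x0)/= mulr0.
have ab : 0 < a + b + 1 by lra.
have key : ((Gamma (a + b + 1))%:E * H 1%R = (Gamma a * Gamma (b + 1))%:E)%E.
  pose F (z : measurableTypeR R * measurableTypeR R) :=
    (pospow (a - 1) (z.1 - z.2) * pospow b z.2 * expR (- z.1))%:E.
  have mF : measurable_fun setT F.
    apply/measurable_EFinP; apply: measurable_funM; last first.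
      by apply: measurableT_comp => //; exact: measurable_funN.
    apply: measurable_funM.
      apply: (@measurableT_comp _ _ _ _ _ _ (pospow (a - 1))).
        exact: measurable_pospow.
      exact: measurable_funB.
    by apply: (@measurableT_comp _ _ _ _ _ _ (pospow b)) => //; exact: measurable_pospow.
  have F0 z : (0 <= F z)%E.
    by rewrite lee_fin mulr_ge0 ?expR_ge0// mulr_ge0 ?pospow_ge0.
  have := @fubini_tonelli _ _ _ _ R leb leb F mF F0; rewrite /F/=.
  have -> : (\int[leb]_x \int[leb]_y
      (pospow (a - 1) (x - y) * pospow b y * expR (- x))%:E =
      (Gamma (a + b + 1))%:E * H 1%R)%E.
    rewrite -Gamma_integral// -ge0_integralZr//; last 2 first.
    - by apply/measurable_EFinP; exact: measurable_gamma_density.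
    - by move=> s _; rewrite lee_fin mulr_ge0 ?expR_ge0// pospow_ge0.
    apply: eq_integral => x _.
    under eq_integral do rewrite EFinM -/(G x _).
    rewrite (@ge0_integralZr _ _ _ leb _ measurableT (G x))//.
    rewrite -/(H x); have [x0|x0] := leP x 0.
      by rewrite HN// /pospow ltNge x0/= mul0r !mul0e.
    by rewrite HZ// /pospow x0 addrK EFinM muleAC.
  move=> ->.
  transitivity (\int[leb]_y ((pospow (b + 1 - 1) y * expR (- y))%:E * (Gamma a)%:E))%E.
    apply: eq_integral => y _; rewrite addrK -Gamma_integral//.
    rewrite -(ge0_integral_translate y); last 2 first.
    - by apply/measurable_EFinP; exact: measurable_gamma_density.
    - by move=> s; rewrite lee_fin mulr_ge0 ?expR_ge0// pospow_ge0.
    rewrite -ge0_integralZl//.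
    - apply: eq_integral => x _; rewrite -EFinM; congr (_%:E).
      have -> : expR (- x) = expR (- y) * expR (- (x - y)).
        by rewrite -expRD; congr expR; ring.
      by ring.
    - apply/measurable_EFinP; apply: (@measurableT_comp _ _ _ _ _ _
        (fun s => pospow (a - 1) s * expR (- s))).
        exact: measurable_gamma_density.
      exact: measurable_funB.
    - by move=> s _; rewrite lee_fin mulr_ge0 ?expR_ge0// pospow_ge0.
    - by rewrite lee_fin mulr_ge0 ?expR_ge0// pospow_ge0.
  rewrite ge0_integralZr//; last 3 first.
  - by apply/measurable_EFinP; exact: measurable_gamma_density.
  - by move=> s _; rewrite lee_fin mulr_ge0 ?expR_ge0// pospow_ge0.
  - by rewrite lee_fin ltW// Gamma_gt0.
  by rewrite Gamma_integral -?EFinM 1?mulrC//; lra.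
have Gab : 0 < Gamma (a + b + 1) by exact: Gamma_gt0.
rewrite -/(H t) HZ// EFinM; congr (_ * _)%E.
rewrite EFinM -key muleC.
by rewrite muleA -EFinM mulVf ?mul1e// gt_eqF.
Qed.

End realline.

(** * Sublinear iteration of a substochastic kernel *)

Section power_inequalities.
Context {R : realType}.
Implicit Types (a c q p lam b m C B : R).

(** Convexity of the power [q]: its graph lies above its tangent at [c]. *)
Lemma powR_tangent q a c : 1 <= q -> 0 <= a -> 0 <= c ->
  q * c `^ (q - 1) * a <= a `^ q + (q - 1) * c `^ q.
Proof.
rewrite le_eqVlt => /predU1P[<-|q1] a0 c0.
  by rewrite subrr powRr0 !mul1r mul0r addr0 powRr1.
have q0 : 0 < q by exact: lt_trans q1.
have q10 : 0 < q - 1 by rewrite subr_gt0.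
have qn : q != 0 by rewrite gt_eqF.
have qn1 : q - 1 != 0 by rewrite gt_eqF.
have e : q^-1 + (q / (q - 1))^-1 = 1 by field; rewrite qn qn1.
have := @conjugate_powR _ a (c `^ (q - 1)) q (q / (q - 1)) a0 (powR_ge0 _ _) q0
  (divr_gt0 q0 q10) e.
rewrite -powRrM mulrCA divff// mulr1 => h.
have -> : a `^ q + (q - 1) * c `^ q = q * (a `^ q / q + c `^ q / (q / (q - 1))).
  by field; rewrite qn qn1.
by rewrite -mulrA (mulrC (c `^ _)) ler_pM2l.
Qed.

Lemma bernoulli_exp (x : R) n : 0 <= x -> 1 + n%:R * x <= (1 + x) ^+ n.
Proof.
move=> x0; elim: n => [|n IH]; first by rewrite mul0r addr0 expr0.
rewrite exprS; apply: (@le_trans _ _ ((1 + x) * (1 + n%:R * x))); last first.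
  by rewrite ler_wpM2l// addr_ge0.
have : 0 <= n%:R * x * x by rewrite !mulr_ge0.
by rewrite -natr1; nra.
Qed.

(** A doubly exponential sequence outgrows every exponential one.  By Bernoulli's
    inequality, [lam ^- (j + i)] exceeds [lam ^- j] by a multiple of [i] that is
    as large as desired when [j] is; it is enough that
    [b ^ (p * (lam^-1 - 1) * lam ^- j)] be at least [2 * C], for then the
    hypothesis at [j + i] bounds [2 ^ i * m] independently of [i]. *)
Lemma double_exponential_absorbs b m C B lam p :
  1 < b -> 1 <= p -> 0 < lam < 1 -> 0 < C -> 0 <= m ->
  (forall k, b `^ (p * lam ^- k) * m <= C ^+ k.+1 * B) -> m = 0.
Proof.
move=> b1 p1 /andP[l0 l1] C0 m0 H.
have b0 : 0 < b by exact: lt_trans b1.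
have p0 : 0 < p by exact: lt_le_trans p1.
have lnb : 0 < ln b by rewrite ln_gt0.
pose e := lam^-1 - 1.
have e0 : 0 < e by rewrite /e subr_gt0 invf_gt1.
have muE k : lam ^- k = (1 + e) ^+ k by rewrite /e addrC subrK exprVn.
pose y := p * e.
have y0 : 0 < y by rewrite mulr_gt0.
have [j jP] : exists j, 2 * C <= b `^ (y * lam ^- j).
  pose D := y * e * ln b.
  have D0 : 0 < D by rewrite /D !mulr_gt0.
  exists (Num.truncn (2 * C / D)).+1; set j := (Num.truncn _).+1.
  have jD : 2 * C <= j%:R * D by rewrite -ler_pdivrMr// ltW// truncnS_gt.
  rewrite /powR gt_eqF//; apply: le_trans (expR_ge1Dx _).
  have := bernoulli_exp _ j (ltW e0); rewrite -muE.
  move=> /(ler_wpM2l (ltW y0)) /(ler_wpM2r (ltW lnb)).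
  rewrite mulrDr mulr1 mulrDl.
  have : 0 <= y * ln b by rewrite mulr_ge0// ltW.
  have -> : y * (j%:R * e) * ln b = j%:R * D by rewrite /D; ring.
  by lra.
have up i : (2 * C) ^+ i <= b `^ (p * lam ^- (j + i)).
  apply: (@le_trans _ _ ((b `^ (y * lam ^- j)) ^+ i)).
    by rewrite lerXn2r// nnegrE ?powR_ge0// mulr_ge0// ltW.
  rewrite -powR_mulrn ?powR_ge0// -powRrM; apply: ler_powR; first exact: ltW.
  have := bernoulli_exp _ i (ltW e0); rewrite -muE.
  have lj : 0 < lam ^- j by rewrite invr_gt0 exprn_gt0.
  have -> : lam ^- (j + i) = lam ^- j * lam ^- i by rewrite exprD invfM.
  move=> h; rewrite /y.
  have -> : p * e * lam ^- j * i%:R = p * (lam ^- j * (i%:R * e)) by ring.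
  rewrite ler_pM2l// ler_pM2l//; lra.
have bd i : i%:R * m <= C ^+ j.+1 * B.
  have := H (j + i)%N; have := up i; rewrite exprMn => h1 h2.
  have Ci : 0 < C ^+ i by rewrite exprn_gt0.
  rewrite -(ler_pM2l Ci).
  have -> : C ^+ i * (C ^+ j.+1 * B) = C ^+ (j + i).+1 * B.
    by rewrite mulrA -exprD addnC.
  apply: le_trans h2; rewrite mulrA ler_wpM2r//; apply: le_trans h1.
  by rewrite mulrC ler_wpM2r ?(ltW Ci)// -natrX ler_nat ltnW// ltn_expl.
apply/eqP; rewrite eq_le m0 andbT leNgt; apply/negP => mp.
have := bd (Num.truncn (C ^+ j.+1 * B / m)).+1.
by rewrite leNgt -ltr_pdivrMr// truncnS_gt.
Qed.

End power_inequalities.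

(** The rows of [k] have mass at most [1], so that averaging against a row obeys
    Jensen's inequality; the columns have mass at most [C], so that integrals
    grow by at most the factor [C]. *)
Section substochastic_kernel.
Context d (S : measurableType d) {R : realType}.
Variables (mu : {sigma_finite_measure set S -> \bar R}) (k : S * S -> R) (C : R).
Hypotheses (mk : measurable_fun setT k) (k0 : forall z, 0 <= k z).
Hypothesis row_le1 : forall z, (\int[mu]_w (k (z, w))%:E <= 1)%E.
Hypotheses (C0 : 0 < C) (col_leC : forall w, (\int[mu]_z (k (z, w))%:E <= C%:E)%E).

Definition kernel_op (g : S -> R) (z : S) : \bar R :=
  (\int[mu]_w (k (z, w) * g w)%:E)%E.

Section nonnegative_argument.
Variable g : S -> R.
Hypotheses (mg : measurable_fun setT g) (g0 : forall w, 0 <= g w).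

Lemma measurable_kernel_integrand :
  measurable_fun setT (fun zw : S * S => (k zw * g zw.2)%:E).
Proof.
apply/measurable_EFinP; apply: measurable_funM => //.
exact: measurableT_comp.
Qed.

Lemma kernel_integrand_ge0 (zw : S * S) : (0 <= (k zw * g zw.2)%:E)%E.
Proof. by rewrite lee_fin mulr_ge0. Qed.

Lemma measurable_kernel_row z : measurable_fun setT (fun w => k (z, w)).
Proof. exact: (measurableT_comp mk (pair1_measurable z)). Qed.

Lemma kernel_op_ge0 z : (0 <= kernel_op g z)%E.
Proof. by apply: integral_ge0 => w _; rewrite lee_fin mulr_ge0. Qed.

Lemma measurable_kernel_op : measurable_fun setT (kernel_op g).
Proof.
exact: (measurable_fun_fubini_tonelli_F _ measurable_kernel_integrand
  kernel_integrand_ge0).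
Qed.

Lemma measurable_fine_kernel_op : measurable_fun setT (fine \o kernel_op g).
Proof.
exact: (measurableT_comp (fine_measurable measurableT) measurable_kernel_op).
Qed.

End nonnegative_argument.

Lemma measurable_powR_fun (g : S -> R) q : measurable_fun setT g ->
  measurable_fun setT (fun w => g w `^ q).
Proof. by move=> mg; exact: (measurableT_comp (measurable_powR q) mg). Qed.

(** Jensen's inequality.  The tangent of the power at the average [c] is
    integrated against a row of the kernel; as the row has mass at most [1], the
    constant term it contributes is at most [(q - 1) * c `^ q]. *)
Lemma kernel_op_jensen (g : S -> R) q z : measurable_fun setT g -> (forall w, 0 <= g w) ->
  1 <= q -> (kernel_op g z < +oo)%E ->
  ((fine (kernel_op g z) `^ q)%:E <= kernel_op (fun w => g w `^ q)%R z)%E.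
Proof.
move=> mg g0 q1 fin; pose c := fine (kernel_op g z).
have c0 : 0 <= c by rewrite fine_ge0// kernel_op_ge0.
have cE : kernel_op g z = c%:E.
  by rewrite fineK// ge0_fin_numE// kernel_op_ge0.
have q0 : 0 < q by exact: lt_le_trans q1.
have gq0 w : 0 <= g w `^ q by exact: powR_ge0.
have mgq := measurable_powR_fun g q mg.
have mrow := measurable_kernel_row z.
have mrowM h : measurable_fun setT h ->
    measurable_fun setT (fun w => (k (z, w) * h w)%:E).
  by move=> mh; apply/measurable_EFinP; exact: measurable_funM.
have s0 : 0 <= q * c `^ (q - 1) by rewrite mulr_ge0 ?powR_ge0// ltW.
have t0 : 0 <= (q - 1) * c `^ q by rewrite mulr_ge0 ?powR_ge0// subr_ge0.
have main : ((q * c `^ q)%:E <=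
    kernel_op (fun w => g w `^ q)%R z + ((q - 1) * c `^ q)%:E)%E.
  have -> : ((q * c `^ q)%:E =
      \int[mu]_w ((q * c `^ (q - 1))%:E * (k (z, w) * g w)%:E))%E.
    rewrite ge0_integralZl_EFin//; last 2 first.
    - by move=> w _; rewrite lee_fin mulr_ge0.
    - exact: mrowM.
    rewrite -/(kernel_op g z) cE -EFinM -mulrA (mulrC _ c) mulr_powRB1//.
  apply: (@le_trans _ _ (\int[mu]_w ((k (z, w) * g w `^ q)%:E +
      ((q - 1) * c `^ q)%:E * (k (z, w))%:E))%E).
    apply: ge0_le_integral => //.
    - by move=> w _; rewrite -EFinM lee_fin mulr_ge0// mulr_ge0.
    - by apply: measurable_funeM; exact: mrowM.
    - apply: emeasurable_funD; first exact: mrowM.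
      by apply: measurable_funeM; exact/measurable_EFinP.
    move=> w _; rewrite -!EFinM -EFinD lee_fin.
    have := ler_wpM2l (k0 (z, w)) (powR_tangent q (g w) c q1 (g0 w) c0).
    by rewrite mulrDr; lra.
  rewrite ge0_integralD//; last 4 first.
  - by move=> w _; rewrite lee_fin mulr_ge0.
  - exact: mrowM.
  - by move=> w _; rewrite -EFinM lee_fin mulr_ge0.
  - by apply: measurable_funeM; exact/measurable_EFinP.
  apply: leeD => //; rewrite ge0_integralZl_EFin//; last 2 first.
  - by move=> w _; rewrite lee_fin.
  - exact/measurable_EFinP.
  by rewrite -[leRHS]mule1 lee_wpmul2l// lee_fin.
rewrite -/c; move: main; rewrite -leeBlDr// -EFinB.
by apply: le_trans; rewrite lee_fin; lra.
Qed.

(** Jensen's inequality in each row, then Tonelli's theorem and the bound on the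
    columns. *)
Lemma integral_powR_kernel_op_le (g : S -> R) q :
  measurable_fun setT g -> (forall w, 0 <= g w) -> 1 <= q ->
  (\forall z \ae mu, (kernel_op g z < +oo)%E) ->
  (\int[mu]_z (fine (kernel_op g z) `^ q)%:E <=
   C%:E * \int[mu]_w (g w `^ q)%:E)%E.
Proof.
move=> mg g0 q1 fin.
have gq0 w : 0 <= g w `^ q by exact: powR_ge0.
have mgq := measurable_powR_fun g q mg.
apply: (@le_trans _ _ (\int[mu]_z kernel_op (fun w => g w `^ q)%R z)%E).
  apply: ae_ge0_le_integral => //.
  - by move=> z _; rewrite lee_fin powR_ge0.
  - apply/measurable_EFinP; apply: measurable_powR_fun.
    exact: measurable_fine_kernel_op.
  - by move=> z _; exact: kernel_op_ge0.
  - exact: measurable_kernel_op.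
  by apply: filterS fin => z fz _; exact: kernel_op_jensen.
rewrite [leLHS](fubini_tonelli _ (measurable_kernel_integrand _ mgq)
  (kernel_integrand_ge0 _ gq0))/=.
rewrite -ge0_integralZl//; last 3 first.
- exact/measurable_EFinP.
- by move=> w _; rewrite lee_fin.
- by rewrite lee_fin ltW.
apply: ge0_le_integral => //.
- by move=> w _; apply: integral_ge0 => z _; rewrite lee_fin mulr_ge0.
- exact: (measurable_fun_fubini_tonelli_G (m1 := mu) _
    (measurable_kernel_integrand _ mgq) (kernel_integrand_ge0 _ gq0)).
- by apply: measurable_funeM; exact/measurable_EFinP.
move=> w _; under eq_integral do rewrite EFinM.
rewrite ge0_integralZr//; last 3 first.
- apply/measurable_EFinP; exact: (measurableT_comp mk (pair2_measurable w)).
- by move=> z _; rewrite lee_fin.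
- by rewrite lee_fin.
by rewrite lee_wpmul2r// lee_fin.
Qed.

(** A subsolution [v <= K (v ^ lam)] stays below [1], as soon as [g] (which
    stands for the right side) lies in a single [L^p].  Jensen's inequality
    bounds the integral of the power [p / lam ^ (k + 1)] of [v] by [C] times that
    of the power [p / lam ^ k]; a set on which [v >= 1 + e] contributes to these
    integrals doubly exponentially in [k], so that it must be null. *)
Lemma sublinear_kernel_op_le1 (g : S -> R) p lam :
  measurable_fun setT g -> (forall w, 0 <= g w) -> 1 <= p -> 0 < lam < 1 ->
  (\int[mu]_w (g w `^ p)%:E < +oo)%E ->
  (\forall z \ae mu, (kernel_op g z < +oo)%E) ->
  (\forall z \ae mu, g z <= fine (kernel_op g z) `^ lam) ->
  \forall z \ae mu, fine (kernel_op g z) <= 1.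
Proof.
move=> mg g0 p1 lam01 gp fin gV; have [l0 l1] := andP lam01.
pose V z := fine (kernel_op g z).
have mV : measurable_fun setT V := measurable_fine_kernel_op g mg g0.
have V0 z : 0 <= V z by rewrite fine_ge0// kernel_op_ge0.
pose q j := p * lam ^- j.
have p0 : 0 < p by exact: lt_le_trans p1.
have q1 j : 1 <= q j.
  rewrite /q mulr_ege1// invf_ge1 ?exprn_gt0// exprn_ile1//; exact: ltW.
pose I j := (\int[mu]_z (V z `^ q j)%:E)%E.
pose B := fine (\int[mu]_w (g w `^ p)%:E)%E.
have BE : (\int[mu]_w (g w `^ p)%:E = B%:E)%E.
  rewrite fineK// ge0_fin_numE//; apply: integral_ge0 => w _.
  by rewrite lee_fin powR_ge0.
have IB j : (I j <= (C ^+ j.+1 * B)%:E)%E.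
  elim: j => [|j IH].
    apply: (le_trans (integral_powR_kernel_op_le _ _ mg g0 (q1 0%N) fin)).
    by rewrite /q expr0 invr1 mulr1 BE expr1 EFinM.
  apply: (le_trans (integral_powR_kernel_op_le _ _ mg g0 (q1 j.+1) fin)).
  rewrite exprS -mulrA EFinM lee_wpmul2l ?lee_fin ?(ltW C0)//.
  apply: le_trans IH; apply: ae_ge0_le_integral => //.
  - by move=> w _; rewrite lee_fin powR_ge0.
  - by apply/measurable_EFinP; exact: measurable_powR_fun.
  - by move=> w _; rewrite lee_fin powR_ge0.
  - by apply/measurable_EFinP; exact: measurable_powR_fun.
  apply: filterS gV => z gz _; rewrite lee_fin.
  have -> : q j = lam * q j.+1.
    by rewrite /q exprS invfM mulrCA mulVKf// gt_eqF.
  rewrite (powRrM _ lam) ge0_ler_powR// ?nnegrE ?powR_ge0//.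
  by apply: le_trans (q1 _).
have small e : 0 < e -> \forall z \ae mu, ~ (1 + e <= V z).
  move=> e0; pose A := [set z | 1 + e <= V z].
  have mA : measurable A.
    have -> : A = setT `&` V @^-1` `[1 + e, +oo[.
      by rewrite setTI; apply/seteqP; split => z; rewrite /A/= in_itv/= andbT.
    exact: mV.
  have e1 : 1 < 1 + e by rewrite ltrDl.
  (* Chebyshev's inequality for the power [q j]. *)
  have cheb j : (((1 + e) `^ q j)%:E * mu A <= (C ^+ j.+1 * B)%:E)%E.
    apply: le_trans (IB j); rewrite -integral_cst//.
    apply: (@le_trans _ _ (\int[mu]_(z in A) (V z `^ q j)%:E)%E); last first.
      apply: ge0_subset_integral => //.
        by apply/measurable_EFinP; exact: measurable_powR_fun.
      by move=> z _; rewrite lee_fin powR_ge0.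
    apply: ge0_le_integral => //.
    - by move=> z _; rewrite lee_fin powR_ge0.
    - apply/measurable_EFinP; apply: measurable_funTS; exact: measurable_powR_fun.
    move=> z Az; rewrite lee_fin ge0_ler_powR// ?nnegrE//.
      by apply: le_trans (q1 j).
    by apply: le_trans (ltW e1).
  have mufin : mu A \is a fin_num.
    rewrite ge0_fin_numE//; apply: le_lt_trans (ltry (C ^+ 1 * B)).
    apply: le_trans (cheb 0%N); rewrite -[leLHS]mul1e lee_wpmul2r// lee_fin.
    by apply: le_trans (le1r_powR (ltW e1) (q1 _)); exact: ltW.
  have muA0 : mu A = 0%E.
    rewrite -(fineK mufin); congr (_%:E).
    apply: (double_exponential_absorbs (1 + e) _ C B lam p) => //.
      by rewrite fine_ge0.
    by move=> j; rewrite -lee_fin EFinM fineK// cheb.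
  exists A; split => // z /=.
  by move=> /contrapT.
have {}small : \forall z \ae mu, forall n : nat, ~ (1 + n.+1%:R^-1 <= V z).
  by apply: ae_foralln => n; apply: small; rewrite invr_gt0.
apply: filterS small => z Hz; rewrite leNgt; apply/negP => V1.
pose n := Num.truncn (V z - 1)^-1.
apply: (Hz n); rewrite -lerBrDl -[leRHS]invrK lef_pV2 ?posrE ?invr_gt0 ?subr_gt0//.
by rewrite ltW// truncnS_gt.
Qed.

End substochastic_kernel.

(** * Lebesgue measure on R^n *)

Section lebesgue_rn.
Context {R : realType}.
Local Notation leb := (@lebesgue_measure R).

Lemma measurable_sqnorm n : measurable_fun setT (@sqnorm R n).
Proof.
apply: measurable_sum => i; apply: measurable_funX.
exact: measurable_tnth.
Qed.

Lemma measurable_sqnorm_le n (r : R) : measurable [set x : n.-tuple R | sqnorm x <= r].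
Proof.
have -> : [set x : n.-tuple R | sqnorm x <= r] =
    setT `&` (@sqnorm R n) @^-1` `]-oo, r].
  by rewrite setTI; apply/seteqP; split => x /=; rewrite in_itv.
exact: measurable_sqnorm.
Qed.

Lemma sqnorm_ge0 n (x : n.-tuple R) : 0 <= sqnorm x.
Proof. by apply: sumr_ge0 => i _; exact: sqr_ge0. Qed.

Lemma sqnorm_cons n (z : measurableTypeR R * n.-tuple R) :
  sqnorm (tuple_of_pair z) = z.1 ^+ 2 + sqnorm z.2.
Proof.
rewrite /sqnorm big_ord_recl tnth0; congr (_ + _).
by apply: eq_bigr => i _; rewrite tnthS.
Qed.

(** A ball of dimension [n + 1] lies in the product of an interval and the ball
    of dimension [n] with the same radius; [r + 1] bounds the square root of
    [r]. *)
Lemma lebesgue_tuple_ball_lt_pinfty n (r : R) :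
  (lebesgue_tuple n [set x | (sqnorm x <= r)%R] < +oo)%E.
Proof.
elim: n => [|n IH] /=.
  by rewrite diracE; case: (_ \in _); rewrite ltry.
rewrite /lebesgue_tuple_step /pushforward.
pose box : set (measurableTypeR R * n.-tuple R) :=
  `[- (r + 1), r + 1]%classic `*` [set x | sqnorm x <= r].
have mitv : measurable (`[- (r + 1), r + 1]%classic : set (measurableTypeR R)).
  exact: measurable_itv.
apply: (@le_lt_trans _ _ ((leb \x^ lebesgue_tuple n)%E box)).
  apply: le_measure; rewrite ?inE.
  - rewrite -[X in measurable X]setTI.
    exact: (measurable_tuple_of_pair measurableT (measurable_sqnorm_le n.+1 r)).
  - exact: (measurableX mitv (measurable_sqnorm_le n r)).
  move=> z /=; rewrite sqnorm_cons => zr; split => /=.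
    rewrite in_itv/=; have := sqnorm_ge0 _ z.2.
    have := sqr_ge0 (z.1 - 1); have := sqr_ge0 (z.1 + 1).
    by nra.
  by apply: le_trans zr; rewrite lerDr sqr_ge0.
rewrite (product_measure2E _ _ mitv (measurable_sqnorm_le n r)) lte_mul_pinfty//.
  have -> : (leb `[- (r + 1), r + 1]%classic \is a fin_num) = true; last by [].
  rewrite ge0_fin_numE// [X in (X < _)%E](lebesgue_measure_itv `[- (r + 1), r + 1]).
  by case: ifP => _; rewrite ?ltry.
Qed.

(** A name for [lebesgue_tuple] that can carry its sigma-finiteness, which
    Tonelli's theorem asks of both factors. *)
Definition lebesgue_rn n : set (n.-tuple R) -> \bar R := lebesgue_tuple n.

HB.instance Definition _ n := Measure.on (@lebesgue_rn n).

Lemma sigma_finite_lebesgue_rn n : sigma_finite setT (@lebesgue_rn n).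
Proof.
exists (fun j => [set x | sqnorm x <= j%:R]).
  apply/esym/seteqP; split => // x _; exists (Num.truncn (sqnorm x)).+1 => //=.
  exact/ltW/truncnS_gt.
move=> j; split; last exact: lebesgue_tuple_ball_lt_pinfty.
exact: measurable_sqnorm_le.
Qed.

HB.instance Definition _ n := @Measure_isSigmaFinite.Build _ _ _
  (@lebesgue_rn n) (sigma_finite_lebesgue_rn n).

Lemma integral_lebesgue_rnS n (F : n.+1.-tuple R -> \bar R) :
  measurable_fun setT F -> (forall x, (0 <= F x)%E) ->
  (\int[@lebesgue_rn n.+1]_x F x =
   \int[leb]_s \int[@lebesgue_rn n]_x F (tuple_of_pair (s, x)))%E.
Proof.
move=> mF F0.
transitivity (\int[(leb \x^ lebesgue_tuple n)%E]_z F (tuple_of_pair z))%E.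
  rewrite -(@ge0_integral_pushforward _ _ _ _ _ (@tuple_of_pair R n)
    (@measurable_tuple_of_pair R n) _ setT F)//.
have mG : measurable_fun setT (F \o @tuple_of_pair R n).
  exact: (measurableT_comp mF (@measurable_tuple_of_pair R n)).
rewrite -[RHS](@fubini_tonelli1 _ _ _ _ _ leb (@lebesgue_rn n) _ mG); last first.
  by move=> z /=.
apply: eq_measure_integral => A mA _; apply/esym.
apply: (@product_measure_unique _ _ _ _ _ leb (@lebesgue_rn n)
  (leb \x^ lebesgue_tuple n)%E) => // X Y mX mY.
exact: product_measure2E.
Qed.

(** Used for the heat kernel, a product of Gaussian densities whose centers
    depend on the coordinate. *)
Lemma integral_prod_eq1 (g : nat -> R -> R) n :
  (forall i, measurable_fun setT (g i)) -> (forall i s, 0 <= g i s) ->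
  (forall i, (\int[leb]_s (g i s)%:E = 1)%E) ->
  (\int[@lebesgue_rn n]_x (\prod_(i < n) g i (tnth x i))%:E = 1)%E.
Proof.
elim: n g => [|n IH] g mg g0 g1.
  under eq_integral do rewrite big_ord0.
  by rewrite integral_cst//= mul1e /lebesgue_rn/= diracT.
rewrite integral_lebesgue_rnS; last 2 first.
- apply/measurable_EFinP; apply: measurable_prod => i _.
  exact: (measurableT_comp (mg i) (measurable_tnth i)).
- by move=> x; rewrite lee_fin prodr_ge0.
rewrite -[RHS](g1 0%N); apply: eq_integral => s _.
rewrite -[RHS]mule1 -(IH (fun i => g i.+1))//.
rewrite -ge0_integralZl_EFin//.
- apply: eq_integral => x _; rewrite -EFinM big_ord_recl tnth0; congr (_ * _)%:E.
  by apply: eq_bigr => i _; rewrite tnthS.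
- by move=> x _; rewrite lee_fin prodr_ge0.
- apply/measurable_EFinP; apply: measurable_prod => i _.
  exact: (measurableT_comp (mg i.+1) (measurable_tnth i)).
Qed.

End lebesgue_rn.

(** * The heat kernel *)

Section heat_kernel.
Context {R : realType} {n : nat}.
Local Notation leb := (@lebesgue_measure R).
Local Notation rn := (@lebesgue_rn R n).
Local Notation S := (spacetime R n).
Implicit Types (x y : n.-tuple R) (a t s : R) (z w : S).

(** The Gaussian factor of [Phi], with real powers in place of inverses, whose
    measurability in [t] is that of the power function. *)
Definition heat t x : R :=
  (4 * pi * t) `^ (- (n%:R / 2)) * expR (- (sqnorm x * (4 * t) `^ (- 1))).

Lemma heat_ge0 t x : 0 <= heat t x.
Proof. by rewrite mulr_ge0 ?powR_ge0 ?expR_ge0. Qed.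

Lemma sqnorm_subt x y :
  sqnorm (subt x y) = \sum_(i < n) (tnth x i - tnth y i) ^+ 2.
Proof. by apply: eq_bigr => i _; rewrite tnth_mktuple. Qed.

Lemma heat_subtC t x y : heat t (subt x y) = heat t (subt y x).
Proof.
rewrite /heat (_ : sqnorm (subt x y) = sqnorm (subt y x))//.
by rewrite !sqnorm_subt; apply: eq_bigr => i _; rewrite -sqrrN opprB.
Qed.

Lemma PhiE a x t : Phi a x t = pospow (a - 1) t / Gamma a * heat t x.
Proof.
rewrite /Phi /pospow; case: ifPn => t0; last by rewrite !mul0r.
rewrite /heat powRN powR_inv1 ?mulr_ge0 ?ltW//.
by rewrite !mulrA.
Qed.

Lemma Phi_ge0 a x t : 0 < a -> 0 <= Phi a x t.
Proof.
move=> a0; rewrite PhiE mulr_ge0 ?heat_ge0// divr_ge0 ?pospow_ge0//.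
exact/ltW/Gamma_gt0.
Qed.

Lemma measurable_heat_subt t x : measurable_fun setT (fun y => heat t (subt x y)).
Proof.
apply: measurable_funM => //; apply: measurableT_comp => //.
apply: measurableT_comp => //; apply: measurable_funM => //.
under eq_fun do rewrite sqnorm_subt.
apply: measurable_sum => i; apply: measurable_funX; apply: measurable_funB => //.
exact: measurable_tnth.
Qed.

(** The heat kernel is a product of Gaussian densities of variance [2 * t], the
    [i]-th one centered at the [i]-th coordinate of [x]. *)
Lemma integral_heat t x : 0 < t -> (\int[rn]_y (heat t (subt x y))%:E = 1)%E.
Proof.
move=> t0; pose s := Num.sqrt (2 * t).
have s0 : s != 0 by rewrite gt_eqF// sqrtr_gt0 mulr_gt0.
have s2 : s ^+ 2 = 2 * t by rewrite sqr_sqrtr// mulr_ge0// ltW.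
rewrite -[RHS](@integral_prod_eq1 _ (fun i => normal_pdf (nth 0 x i) s) n).
- apply: eq_integral => y _; congr (_%:E).
  rewrite /heat sqnorm_subt mulr_suml -sumrN expR_sum.
  have -> : (4 * pi * t) `^ (- (n%:R / 2)) = \prod_(i < n) normal_peak s.
    rewrite prodr_const card_ord /normal_peak s2 powRN (mulrC n%:R) powRrM powR12_sqrt.
      rewrite powR_mulrn ?sqrtr_ge0// exprVn; congr ((Num.sqrt _ ^+ _)^-1).
      by rewrite -mulr_natr; ring.
    by rewrite !mulr_ge0// ?pi_ge0// ltW.
  rewrite -big_split/=; apply: eq_bigr => i _.
  rewrite normal_pdfE// /= /normal_fun s2; congr (_ * expR _).
  rewrite (tnth_nth 0 x) powR_inv1 ?mulr_ge0 ?ltW// -mulrnAl mulNr; congr (- (_ / _)).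
    by rewrite -sqrrN opprB.
  by rewrite -mulr_natr; ring.
- by move=> i; exact: measurable_normal_pdf.
- by move=> i r; exact: normal_pdf_ge0.
- by move=> i; exact: integral_normal_pdf.
Qed.

Lemma measurable_Phi_subt a : measurable_fun setT
  (fun zw : S * S => Phi a (subt zw.1.1 zw.2.1) (zw.1.2 - zw.2.2)).
Proof.
under eq_fun do rewrite PhiE.
have mt : measurable_fun setT (fun zw : S * S => zw.1.2 - zw.2.2).
  by apply: measurable_funB; exact: measurableT_comp.
have mx : measurable_fun setT (fun zw : S * S => sqnorm (subt zw.1.1 zw.2.1)).
  under eq_fun do rewrite sqnorm_subt.
  apply: measurable_sum => i; apply: measurable_funX; apply: measurable_funB.
    apply: (measurableT_comp (measurable_tnth i)); exact: measurableT_comp.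
  apply: (measurableT_comp (measurable_tnth i)); exact: measurableT_comp.
apply: measurable_funM.
  apply: measurable_funM => //.
  exact: (measurableT_comp (measurable_pospow (a - 1)) mt).
apply: measurable_funM.
  apply: (measurableT_comp (measurable_powR _)); exact: measurable_funM.
apply: (measurableT_comp (@measurable_expR R)).
apply: measurableT_comp => //; apply: measurable_funM => //.
apply: (measurableT_comp (measurable_powR _)); exact: measurable_funM.
Qed.

Lemma sigma_finite_lebesgue_spacetime :
  sigma_finite setT (@lebesgue_spacetime R n).
Proof.
exists (fun j => [set x | sqnorm x <= j%:R] `*` `[- j%:R, j%:R]%classic).
  apply/esym/seteqP; split => // z _.
  pose j := (Num.truncn (Num.max (sqnorm z.1) `|z.2|)).+1; exists j => //.
  have : Num.max (sqnorm z.1) `|z.2| <= j%:R by exact/ltW/truncnS_gt.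
  by rewrite ge_max => /andP[? ?]; split => //=; rewrite in_itv/= -ler_norml.
move=> j.
have mI : measurable (`[- j%:R, j%:R]%classic : set (measurableTypeR R)).
  exact: measurable_itv.
have mB := @measurable_sqnorm_le R n j%:R.
split; first exact: measurableX.
have := product_measure1E rn leb mB mI; rewrite /lebesgue_spacetime => ->.
apply: lte_mul_pinfty => //.
  by rewrite ge0_fin_numE//; exact: lebesgue_tuple_ball_lt_pinfty.
rewrite [X in (X < _)%E](lebesgue_measure_itv `[- j%:R, j%:R]).
by case: ifP => _; rewrite ?ltry.
Qed.

HB.instance Definition _ := @Measure_isSigmaFinite.Build _ _ _
  (@lebesgue_spacetime R n) sigma_finite_lebesgue_spacetime.

Local Notation mu := (@lebesgue_spacetime R n).

Lemma integral_spacetime (F : S -> \bar R) :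
  measurable_fun setT F -> (forall z, (0 <= F z)%E) ->
  (\int[mu]_z F z = \int[leb]_t \int[rn]_x F (x, t))%E.
Proof.
move=> mF F0; exact: (@fubini_tonelli2 _ _ _ _ _ rn leb F mF F0).
Qed.

(** Integrating the kernel over space leaves the fractional integral in time. *)
Lemma integral_Phi_row a z (h : R -> R) : 0 < a ->
  measurable_fun setT h -> (forall t, 0 <= h t) ->
  (\int[mu]_w (Phi a (subt z.1 w.1) (z.2 - w.2) * h w.2)%:E =
   \int[leb]_s (pospow (a - 1) (z.2 - s) / Gamma a * h s)%:E)%E.
Proof.
move=> a0 mh h0; rewrite integral_spacetime//=; last 2 first.
- apply/measurable_EFinP; apply: measurable_funM.
    exact: (measurableT_comp (measurable_Phi_subt a) (pair1_measurable z)).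
  exact: measurableT_comp.
- by move=> w; rewrite lee_fin mulr_ge0// Phi_ge0.
apply: eq_integral => s _.
under eq_integral do rewrite PhiE mulrAC EFinM.
have [s0|s0] := leP (z.2 - s) 0.
  rewrite /pospow ltNge s0/= !mul0r; under eq_integral do rewrite mul0e.
  by rewrite integral0.
rewrite ge0_integralZl_EFin//.
- by rewrite integral_heat// mule1.
- by move=> y _; rewrite lee_fin heat_ge0.
- by apply/measurable_EFinP; exact: measurable_heat_subt.
- by rewrite mulr_ge0// divr_ge0 ?pospow_ge0// ltW// Gamma_gt0.
Qed.

Lemma integral_Phi_col a w (h : R -> R) : 0 < a ->
  measurable_fun setT h -> (forall t, 0 <= h t) ->
  (\int[mu]_z (Phi a (subt z.1 w.1) (z.2 - w.2) * h z.2)%:E =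
   \int[leb]_t (pospow (a - 1) (t - w.2) / Gamma a * h t)%:E)%E.
Proof.
move=> a0 mh h0; rewrite integral_spacetime//=; last 2 first.
- apply/measurable_EFinP; apply: measurable_funM.
    exact: (measurableT_comp (measurable_Phi_subt a) (pair2_measurable w)).
  exact: measurableT_comp.
- by move=> z; rewrite lee_fin mulr_ge0// Phi_ge0.
apply: eq_integral => t _.
under eq_integral do rewrite PhiE heat_subtC mulrAC EFinM.
have [t0|t0] := leP (t - w.2) 0.
  rewrite /pospow ltNge t0/= !mul0r; under eq_integral do rewrite mul0e.
  by rewrite integral0.
rewrite ge0_integralZl_EFin//.
- by rewrite integral_heat// mule1.
- by move=> x _; rewrite lee_fin heat_ge0.
- by apply/measurable_EFinP; exact: measurable_heat_subt.
- by rewrite mulr_ge0// divr_ge0 ?pospow_ge0// ltW// Gamma_gt0.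
Qed.

End heat_kernel.

(** * Solutions that depend only on time *)

Section barrier.
Context {R : realType}.
Local Notation leb := (@lebesgue_measure R).
Variables (a lam : R).
Hypotheses (a0 : 0 < a) (lam01 : 0 < lam < 1).
Implicit Types (e s t : R).

Let b : R := a * lam / (1 - lam).
Let M : R := Gamma (b + 1) / Gamma (a + b + 1).
Let c : R := M `^ (1 / (1 - lam)).

(** The solution [t |-> (M * t ^ a) ^ (1 / (1 - lam))] of the fractional equation
    started at time [- e] instead of [0], so that it is positive at time [0]. *)
Definition barrier e t : R := c * pospow (a + b) (t + e).

(** The power [lam] of the barrier ([powR_barrier]), whose fractional integral
    is the barrier again. *)
Definition barrier_source e t : R := c `^ lam * pospow b (t + e).

Let lam0 : 0 < lam. Proof. by case/andP: lam01. Qed.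
Let lam1 : 0 < 1 - lam. Proof. by case/andP: lam01; rewrite subr_gt0. Qed.
Let b0 : 0 < b. Proof. by rewrite divr_gt0// mulr_gt0. Qed.
Let M0 : 0 < M.
Proof. by rewrite divr_gt0// Gamma_gt0// ?addr_gt0. Qed.
Let c0 : 0 < c. Proof. exact: powR_gt0. Qed.

Let abE : a + b = a * (1 / (1 - lam)).
Proof. by rewrite /b; field; rewrite gt_eqF. Qed.

Let ab_lam : (a + b) * lam = b.
Proof. by rewrite abE /b; field; rewrite gt_eqF. Qed.

Lemma barrierE e t : 0 < t + e ->
  barrier e t = (M * (t + e) `^ a) `^ (1 / (1 - lam)).
Proof.
move=> te; rewrite /barrier /pospow te abE powRrM powRM ?powR_ge0//.
exact: ltW.
Qed.

Lemma barrier_gt0 e t : 0 < t + e -> 0 < barrier e t.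
Proof. by move=> te; rewrite /barrier /pospow te mulr_gt0// powR_gt0. Qed.

Lemma barrier_source_gt0 e t : 0 < t + e -> 0 < barrier_source e t.
Proof. by move=> te; rewrite /barrier_source /pospow te mulr_gt0// powR_gt0. Qed.

Lemma barrier_ge0 e t : 0 <= barrier e t.
Proof. by rewrite mulr_ge0 ?pospow_ge0// ltW. Qed.

Lemma barrier_source_ge0 e t : 0 <= barrier_source e t.
Proof. by rewrite mulr_ge0 ?pospow_ge0 ?powR_ge0. Qed.

Let pospow_le q s t : 0 <= q -> s <= t -> pospow q s <= pospow q t.
Proof.
move=> q0 st; rewrite /pospow; case: ifPn => [s0|_]; last first.
  by case: ifP => // _; exact: powR_ge0.
have t0 := lt_le_trans s0 st.
by rewrite t0 ge0_ler_powR// nnegrE ltW.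
Qed.

Lemma barrier_le e s t : s <= t -> barrier e s <= barrier e t.
Proof.
move=> st; rewrite ler_pM2l//; apply: pospow_le; last by rewrite lerD2r.
by rewrite addr_ge0 ?ltW.
Qed.

Lemma barrier_source_le e s t : s <= t ->
  barrier_source e s <= barrier_source e t.
Proof.
move=> st; rewrite ler_pM2l ?powR_gt0//; apply: pospow_le; last by rewrite lerD2r.
exact: ltW.
Qed.

Lemma measurable_barrier e : measurable_fun setT (barrier e).
Proof.
apply: measurable_funM => //; apply: (measurableT_comp (measurable_pospow _)).
by apply: measurable_funD.
Qed.

Lemma measurable_barrier_source e : measurable_fun setT (barrier_source e).
Proof.
apply: measurable_funM => //; apply: (measurableT_comp (measurable_pospow _)).
by apply: measurable_funD.
Qed.

Lemma powR_barrier e t : 0 < t + e -> barrier e t `^ lam = barrier_source e t.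
Proof.
move=> te; rewrite /barrier /barrier_source /pospow te.
by rewrite powRM ?powR_ge0 ?(ltW c0)// -powRrM ab_lam.
Qed.

(** The beta integral, translated by [e]; [c] is chosen so that
    [c ^ lam * M = c]. *)
Lemma frac_integral_barrier_source e t : 0 < t + e ->
  (\int[leb]_s (pospow (a - 1) (t - s) / Gamma a * barrier_source e s)%:E =
   (barrier e t)%:E)%E.
Proof.
move=> te.
pose G (s : measurableTypeR R) := (pospow (a - 1) (t + e - s) * pospow b s)%:E.
have G0 s : (0 <= G s)%E by rewrite lee_fin mulr_ge0 ?pospow_ge0.
have mG : measurable_fun setT G.
  apply/measurable_EFinP; apply: measurable_funM; last exact: measurable_pospow.
  exact: measurable_frac_kernel.
have Ga := Gamma_gt0 a a0.
transitivity (\int[leb]_s ((c `^ lam / Gamma a)%:E * G (s - - e)%R))%E.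
  apply: eq_integral => s _; rewrite /G /barrier_source opprK -EFinM.
  have -> : t + e - (s + e) = t - s by ring.
  by congr (_%:E); ring.
rewrite ge0_integralZl_EFin//; last 2 first.
- apply: (measurableT_comp mG); exact: measurable_funD.
- by rewrite divr_ge0 ?powR_ge0// ltW.
rewrite (ge0_integral_translate _ _ mG G0).
rewrite [X in (_ * X)%E](integral_pospow_convolution a b (t + e))//; last first.
  by apply: lt_trans b0; rewrite ltrN10.
rewrite -EFinM; congr (_%:E); rewrite /barrier /pospow te.
have cM : c `^ lam * M = c.
  rewrite /c -powRrM -[X in _ * X](@powRr1 _ M) ?(ltW M0)// -powRD; last first.
    by rewrite (gt_eqF M0) implybT.
  by congr (_ `^ _); field; rewrite gt_eqF.
rewrite -[X in _ = X * _]cM /M; field.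
by rewrite !gt_eqF// Gamma_gt0// !addr_gt0.
Qed.

End barrier.

(** * Comparison with the barrier *)

Lemma measurable_fun_invr {R : realType} d (S : measurableType d) (h : S -> R) :
  measurable_fun setT h -> (forall z, 0 <= h z) ->
  measurable_fun setT (fun z => (h z)^-1).
Proof.
move=> mh h0; under eq_fun do rewrite -powR_inv1//.
exact: (measurableT_comp (measurable_powR _)).
Qed.

Section comparison.
Context {R : realType} {n : nat}.
Local Notation leb := (@lebesgue_measure R).
Local Notation S := (spacetime R n).
Local Notation mu := (@lebesgue_spacetime R n).
Variables (p a lam e T : R).
Hypotheses (p1 : 1 <= p) (a0 : 0 < a) (lam01 : 0 < lam < 1).
Hypotheses (e0 : 0 < e) (T0 : 0 < T).
Variables f u : S -> R.
Hypotheses (fX : X p f) (fu : J_eq a f u).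
Hypothesis f_le : \forall z \ae mu, 0 <= f z <= u z `^ lam.
Hypothesis u_past : \forall z \ae mu, z.2 < 0 -> u z = 0.

Let w := barrier a lam e.
Let v := barrier_source a lam e.
Let slab (z : S) : bool := (0 <= z.2) && (z.2 < T).

Let w0 t : 0 <= t -> 0 < w t.
Proof. by move=> t0; apply: barrier_gt0 => //; rewrite ltr_wpDl. Qed.

Let v0 t : 0 <= t -> 0 < v t.
Proof. by move=> t0; apply: barrier_source_gt0 => //; rewrite ltr_wpDl. Qed.

Let vge0 t : 0 <= v t. Proof. exact: barrier_source_ge0. Qed.

Let mslab : measurable_fun setT slab.
Proof. by apply: measurable_and; [exact: measurable_fun_ler|exact: measurable_fun_ltr]. Qed.

Let Phi2 (z w : S) : R := Phi a (subt z.1 w.1) (z.2 - w.2).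

Let Phi2_ge0 z y : 0 <= Phi2 z y. Proof. exact: Phi_ge0. Qed.

Let Phi2_future (z y : S) : z.2 <= y.2 -> Phi2 z y = 0.
Proof. by move=> zy; rewrite /Phi2 /Phi subr_gt0 ltNge zy. Qed.

Let k (zy : S * S) : R :=
  if slab zy.1 then Phi2 zy.1 zy.2 * v zy.2.2 / w zy.1.2 else 0.

(* The positive part makes [g] nonnegative everywhere, and not only almost
   everywhere. *)
Let g (y : S) : R := if slab y then Num.max (f y) 0 / v y.2 else 0.

Let mf : measurable_fun setT f. Proof. by case: fX. Qed.

Let mk : measurable_fun setT k.
Proof.
apply: measurable_fun_ifT => //; first exact: measurableT_comp.
apply: measurable_funM.
  apply: measurable_funM; first exact: measurable_Phi_subt.
  apply: (measurableT_comp (measurable_barrier_source _ _ _)).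
  exact: measurableT_comp.
apply: measurable_fun_invr => [|zy]; last exact: barrier_ge0.
apply: (measurableT_comp (measurable_barrier _ _ _)); exact: measurableT_comp.
Qed.

Let k0 zy : 0 <= k zy.
Proof.
rewrite /k; case: ifP => // /andP[t0 _].
by rewrite divr_ge0 ?(ltW (w0 _ t0))// mulr_ge0.
Qed.

Let mg : measurable_fun setT g.
Proof.
apply: measurable_fun_ifT => //; apply: measurable_funM; first exact: measurable_maxr.
apply: measurable_fun_invr => [|y]; last exact: vge0.
by apply: (measurableT_comp (measurable_barrier_source _ _ _)).
Qed.

Let g0 y : 0 <= g y.
Proof. by rewrite /g; case: ifP => // _; rewrite divr_ge0// le_max lexx orbT. Qed.

Let row_le1 z : (\int[mu]_y (k (z, y))%:E <= 1)%E.
Proof.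
have [zs|/negbTE zs] := boolP (slab z); last first.
  by rewrite integral0_eq// => y _; rewrite /k/= zs.
have t0 : 0 <= z.2 by case/andP: zs.
under eq_integral do rewrite /k/= zs mulrC EFinM.
have wi : 0 <= (w z.2)^-1 by rewrite invr_ge0 ltW// w0.
rewrite ge0_integralZl_EFin//; last 2 first.
- by move=> y _; rewrite lee_fin mulr_ge0.
- apply/measurable_EFinP; apply: measurable_funM.
    exact: (measurableT_comp (measurable_Phi_subt a) (pair1_measurable z)).
  by apply: (measurableT_comp (measurable_barrier_source _ _ _)).
rewrite integral_Phi_row//; last exact: measurable_barrier_source.
rewrite frac_integral_barrier_source//; last by rewrite ltr_wpDl.
by rewrite -EFinM mulVf// gt_eqF// w0.
Qed.

Let C : R := v T / w 0 * expR (T + e).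

Let C0 : 0 < C.
Proof. by rewrite mulr_gt0 ?expR_gt0// divr_gt0 ?w0// v0// ltW. Qed.

(* For a point of the slab seen by the kernel, the time lag is less than
   [T + e]; the factor [expR (T + e)] pays for the exponential that makes the
   power integrable over an unbounded time. *)
Let col_leC y : (\int[mu]_z (k (z, y))%:E <= C%:E)%E.
Proof.
pose h t := C * expR (- (t - y.2)).
have h0 t : 0 <= h t by rewrite mulr_ge0 ?expR_ge0// ltW.
have mh : measurable_fun setT h.
  apply: measurable_funM => //; apply: (measurableT_comp (@measurable_expR R)).
  by apply: measurableT_comp => //; exact: measurable_funB.
have mkcol : measurable_fun setT (fun z => k (z, y)).
  exact: (measurableT_comp mk (pair2_measurable y)).
have Ga := Gamma_gt0 a a0.
apply: (@le_trans _ _ (\int[mu]_z (Phi2 z y * h z.2)%:E)%E).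
  apply: ge0_le_integral => //.
  - by move=> z _; rewrite lee_fin.
  - exact/measurable_EFinP.
  - apply/measurable_EFinP; apply: measurable_funM.
      exact: (measurableT_comp (measurable_Phi_subt a) (pair2_measurable y)).
    exact: (measurableT_comp mh).
  move=> z _; rewrite lee_fin /k/=; case: ifPn => [/andP[z0 zT]|_]; last first.
    by rewrite mulr_ge0.
  have [zy|yz] := leP z.2 y.2; first by rewrite Phi2_future// !mul0r.
  rewrite -mulrA ler_wpM2l//.
  have [ye|ye] := leP (y.2 + e) 0.
    by rewrite /v /barrier_source /pospow ltNge ye/= mulr0 mul0r.
  rewrite /h /C -mulrA -expRD; apply: (@le_trans _ _ (v T / w 0)).
    apply: ler_pM => //; first by rewrite invr_ge0 ltW// w0.
      by apply: barrier_source_le => //; apply: ltW; exact: lt_trans zT.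
    by rewrite lef_pV2 ?posrE ?w0//; exact: barrier_le.
  rewrite ler_peMr//; first by rewrite divr_ge0 ?(ltW (w0 _ _)).
  by rewrite -expR0 ler_expR; lra.
rewrite integral_Phi_col//.
pose G (s : measurableTypeR R) := (pospow (a - 1) s * expR (- s))%:E.
have mG : measurable_fun setT G.
  by apply/measurable_EFinP; exact: measurable_gamma_density.
have G0 s : (0 <= G s)%E by rewrite lee_fin mulr_ge0 ?pospow_ge0 ?expR_ge0.
rewrite (_ : (\int[leb]_t _)%E =
    (\int[leb]_t ((C / Gamma a)%:E * G (t - y.2)%R))%E); last first.
  apply: eq_integral => t _; rewrite /G -EFinM /h; congr (_%:E); ring.
rewrite ge0_integralZl_EFin//; last 2 first.
- by apply: (measurableT_comp mG); exact: measurable_funB.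
- by rewrite divr_ge0// ltW.
rewrite (ge0_integral_translate _ _ mG G0) [X in (_ * X)%E]Gamma_integral//.
by rewrite -EFinM divfK// gt_eqF.
Qed.

Let f_past : \forall z \ae mu, z.2 < 0 -> f z = 0.
Proof.
apply: filterS2 f_le u_past => z /andP[fz fz'] uz z0.
apply/eqP; rewrite eq_le fz andbT; apply: le_trans fz' _.
by rewrite uz// powR0// gt_eqF//; case/andP: lam01.
Qed.

(* The source [f] up to a null set, as [f] vanishes before time [0]. *)
Let F (y : S) : R := if 0 <= y.2 then Num.max (f y) 0 else 0.

Let F0 y : 0 <= F y.
Proof. by rewrite /F; case: ifP => // _; rewrite le_max lexx orbT. Qed.

Let mF : measurable_fun setT F.
Proof.
apply: measurable_fun_ifT => //; first exact: measurable_fun_ler.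
exact: measurable_maxr.
Qed.

Let mPhi2 z (h : S -> R) : measurable_fun setT h ->
  measurable_fun setT (fun y => (Phi2 z y * h y)%:E).
Proof.
move=> mh; apply/measurable_EFinP; apply: measurable_funM => //.
exact: (measurableT_comp (measurable_Phi_subt a) (pair1_measurable z)).
Qed.

Let JE z : J a f z = (\int[mu]_y (Phi2 z y * F y)%:E)%E.
Proof.
transitivity (\int[mu]_y (Phi2 z y * f y)%:E)%E.
  rewrite /J integral_mkcond; apply: eq_integral => y _.
  rewrite patchE; case: ifPn => //; rewrite notin_setE/= => /negP.
  by rewrite -leNgt => /Phi2_future ->; rewrite mul0r.
apply: ae_eq_integral => //; [exact: mPhi2|exact: mPhi2|].
apply: filterS2 f_le f_past => y /andP[fy _] fy0 _; congr (_ * _)%:E.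
by rewrite /F; case: leP => [_|/fy0//]; rewrite max_l.
Qed.

Let J_ge0 z : (0 <= J a f z)%E.
Proof. by rewrite JE; apply: integral_ge0 => y _; rewrite lee_fin mulr_ge0. Qed.

Let kernel_op_slab z : slab z -> kernel_op _ _ mu k g z = ((w z.2)^-1%:E * J a f z)%E.
Proof.
move=> zs; have /andP[z0 zT] := zs.
rewrite JE -ge0_integralZl_EFin//; last 3 first.
- by move=> y _; rewrite lee_fin mulr_ge0.
- exact: mPhi2.
- by rewrite invr_ge0 ltW// w0.
apply: eq_integral => y _; rewrite -EFinM /k/= zs /g /F; congr (_%:E).
case: ifPn => [/andP[y0 yT]|].
  by rewrite y0; field; rewrite !gt_eqF// ?w0// v0.
rewrite /slab negb_and -ltNge -leNgt => /orP[y0|Ty].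
  by rewrite leNgt y0/= !mulr0.
by rewrite Phi2_future ?mul0r ?mulr0// (le_trans (ltW zT)).
Qed.

Let g_pow : (\int[mu]_y (g y `^ p)%:E < +oo)%E.
Proof.
have p0 : 0 < p by exact: lt_le_trans p1.
pose h (y : S) : R := if y.2 < T then `|f y| `^ p else 0.
have h0 y : 0 <= h y by rewrite /h; case: ifP => // _; exact: powR_ge0.
have mh : measurable_fun setT h.
  apply: measurable_fun_ifT => //; first exact: measurable_fun_ltr.
  by apply: (measurableT_comp (measurable_powR _)); exact: measurableT_comp.
have hfin : (\int[mu]_y (h y)%:E < +oo)%E.
  have -> : (\int[mu]_y (h y)%:E =
      Lnorm_on p%:E [set z | (z.2 < T)%R] f `^ p)%E.
    rewrite /Lnorm_on powR_Lnorm ?gt_eqF//; apply: eq_integral => y _.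
    rewrite patchE /h; case: ifPn => yT.
      by rewrite mem_set.
    rewrite memNset; last by rewrite /=; exact/negP.
    by rewrite abse0 poweR0r// gt_eqF.
  by apply: poweR_lty; case: fX => _; exact.
have v00 : 0 < v 0 by exact: v0.
apply: (@le_lt_trans _ _ (\int[mu]_y (((v 0)^-1 `^ p)%:E * (h y)%:E))%E).
  apply: ge0_le_integral => //.
  - by move=> y _; rewrite lee_fin powR_ge0.
  - apply/measurable_EFinP; exact: (measurableT_comp (measurable_powR _)).
  - by apply: measurable_funeM; exact/measurable_EFinP.
  move=> y _; rewrite -EFinM lee_fin /g; case: ifPn => [/andP[y0 yT]|_].
    rewrite /h yT -powRM ?invr_ge0 ?(ltW v00)// ge0_ler_powR ?(ltW p0) ?nnegrE//.
    - by rewrite divr_ge0// le_max lexx orbT.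
    - by rewrite mulr_ge0// invr_ge0 ltW.
    rewrite mulrC ler_pM ?invr_ge0// ?le_max ?lexx ?orbT//.
      by rewrite lef_pV2 ?posrE// ?v0//; exact: barrier_source_le.
    by rewrite ge_max ler_norm normr_ge0.
  by rewrite powR0 ?gt_eqF// mulr_ge0 ?powR_ge0.
rewrite ge0_integralZl_EFin ?powR_ge0//.
- by rewrite lte_mul_pinfty// lee_fin powR_ge0.
- by move=> y _; rewrite lee_fin.
- exact/measurable_EFinP.
Qed.

Let powR_invw z : 0 <= z -> (w z)^-1 `^ lam = (v z)^-1.
Proof.
move=> z0; have te : 0 < z + e by rewrite ltr_wpDl.
rewrite -powR_inv1 ?(ltW (w0 _ z0))// powRAC powR_inv1 ?powR_ge0//.
by rewrite powR_barrier.
Qed.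

(** On the slab the kernel operator maps [g] to [u / w], to which the iteration
    applies because [f / w ^ lam <= (u / w) ^ lam]. *)
Lemma le_barrier : \forall z \ae mu, 0 <= z.2 < T -> 0 <= u z <= w z.2.
Proof.
have op0 z : ~~ slab z -> kernel_op _ _ mu k g z = 0%E.
  by move=> /negbTE zs; rewrite /kernel_op integral0_eq// => y _; rewrite /k/= zs mul0r.
have opE : \forall z \ae mu, kernel_op _ _ mu k g z =
    (if slab z then u z / w z.2 else 0)%:E.
  apply: filterS fu => z Jz; case: ifPn => zs; last exact: op0.
  by rewrite kernel_op_slab// Jz -EFinM mulrC.
have u0 : \forall z \ae mu, 0 <= u z.
  by apply: filterS fu => z Jz; rewrite -lee_fin -Jz J_ge0.
have fin : \forall z \ae mu, (kernel_op _ _ mu k g z < +oo)%E.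
  by apply: filterS opE => z ->; rewrite ltry.
have gV : \forall z \ae mu, g z <= fine (kernel_op _ _ mu k g z) `^ lam.
  near=> z.
  have -> : kernel_op _ _ mu k g z = (if slab z then u z / w z.2 else 0)%:E.
    by near: z.
  have /andP[fz fuz] : 0 <= f z <= u z `^ lam by near: z.
  have uz : 0 <= u z by near: z.
  rewrite /= /g; case: ifPn => [/andP[z0 _]|_]; last exact: powR_ge0.
  rewrite powRM// ?invr_ge0 ?(ltW (w0 _ z0))// max_l//.
  by rewrite powR_invw// ler_wpM2r// invr_ge0.
have := sublinear_kernel_op_le1 _ _ mu k C mk k0 row_le1 C0 col_leC g p lam mg g0
  p1 lam01 g_pow fin gV.
apply: filterS3 opE u0 => z -> uz + zs; rewrite /slab zs uz/=.
by rewrite ler_pdivrMr ?mul1r// w0//; case/andP: zs.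
Unshelve. all: by end_near. Qed.

End comparison.

Section limit.
Context {R : realType} {n : nat}.
Local Notation S := (spacetime R n).
Local Notation mu := (@lebesgue_spacetime R n).

Lemma Lnorm_on_pinfty_le (D : set S) (h : S -> R) (B : R) : 0 <= B ->
  (\forall z \ae mu, D z -> `|h z| <= B) -> (Lnorm_on +oo D h <= B%:E)%E.
Proof.
move=> B0 hB; rewrite /Lnorm_on unlock; case: ifP => _; last by rewrite lee_fin.
apply/ess_supP; apply: filterS hB => z hz /=; rewrite patchE.
by case: ifPn => [/[!inE]/hz//|_]; rewrite ?abse0 lee_fin.
Qed.

Lemma cvg_barrier a lam (T : R) : 0 < a -> 0 < lam < 1 -> 0 < T ->
  barrier a lam (m.+1%:R^-1) T @[m --> \oo] --> barrier a lam 0 T.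
Proof.
move=> a0 lam01 T0.
have -> : (fun m : nat => barrier a lam (m.+1%:R^-1) T) = (fun m =>
    (Gamma (a * lam / (1 - lam) + 1) / Gamma (a + a * lam / (1 - lam) + 1)) `^
      (1 / (1 - lam)) * (T + m.+1%:R^-1) `^ (a + a * lam / (1 - lam))).
  by apply/funext => m; rewrite /barrier /pospow addr_gt0// invr_gt0.
rewrite /barrier /pospow addr0 T0; apply: cvgMr.
apply: (@cvg_comp _ _ _ (fun m : nat => T + m.+1%:R^-1)
  (fun s => s `^ (a + a * lam / (1 - lam))) _ (nbhs T)).
  have -> : nbhs T = nbhs (T + 0) by rewrite addr0.
  by apply: cvgD; [exact: cvg_cst|exact: cvg_harmonic].
exact: continuous_powR.
Qed.

Lemma le_barrier0 p a lam (T : R) (f u : S -> R) :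
  1 <= p -> 0 < a -> 0 < lam < 1 -> 0 < T -> X p f -> J_eq a f u ->
  (\forall z \ae mu, 0 <= f z <= u z `^ lam) ->
  (\forall z \ae mu, z.2 < 0 -> u z = 0) ->
  \forall z \ae mu, 0 < z.2 < T -> 0 <= u z <= barrier a lam 0 T.
Proof.
move=> p1 a0 lam01 T0 fX fu fle upast.
have h (m : nat) : \forall z \ae mu, 0 <= z.2 < T ->
    0 <= u z <= barrier a lam (m.+1%:R^-1) z.2.
  by apply: (le_barrier p a lam _ T p1 a0 lam01 _ T0 f u fX fu fle upast); rewrite invr_gt0.
have {}h := ae_foralln h.
apply: filterS h => z hz /andP[z0 zT].
have {}hz (m : nat) : 0 <= u z <= barrier a lam (m.+1%:R^-1) T.
  have /andP[-> ub] : 0 <= u z <= barrier a lam (m.+1%:R^-1) z.2.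
    by apply: hz; rewrite (ltW z0).
  by apply: le_trans ub _; apply: barrier_le => //; exact: ltW.
have /andP[-> _] := hz 0%N.
have cb := @cvg_barrier a lam T a0 lam01 T0.
rewrite -(cvg_lim _ cb)//; apply: limr_ge; first by apply/cvg_ex; eexists; exact: cb.
by apply: nearW => m; case/andP: (hz m).
Qed.

Lemma ae_norm_le_barrier0 p a lam (T : R) (f u : S -> R) :
  1 <= p -> 0 < a -> 0 < lam < 1 -> 0 < T -> X p f -> J_eq a f u ->
  (\forall z \ae mu, 0 <= f z <= u z `^ lam) ->
  (\forall z \ae mu, z.2 < 0 -> u z = 0) ->
  (\forall z \ae mu, 0 < z.2 < T -> `|u z| <= barrier a lam 0 T) /\
  (\forall z \ae mu, 0 < z.2 < T -> `|f z| <= barrier a lam 0 T `^ lam).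
Proof.
move=> p1 a0 lam01 T0 fX fu fle upast.
have ub := le_barrier0 p a lam T f u p1 a0 lam01 T0 fX fu fle upast.
have l0 : 0 < lam by case/andP: lam01.
have aeF : Filter (nbhs (almost_everywhere mu)) by exact: _.
split; first by apply: filterS ub => z uz /uz/andP[u0 uB]; rewrite ger0_norm.
apply: filterS2 fle ub => z /andP[f0 fu'] uz /uz/andP[u0 uB].
rewrite ger0_norm//; apply: le_trans fu' _.
by rewrite ge0_ler_powR ?nnegrE ?(ltW l0)//; exact: le_trans uB.
Qed.

End limit.

Theorem theorem3p2 (R : realType) (n : nat) (p alpha lambda : R)
    (u : spacetime R n -> R) :
  (1 <= n)%N ->
  (1 < p /\ 0 < alpha < (n%:R + 2) / (2 * p)) \/
    (p = 1 /\ 0 < alpha <= (n%:R + 2) / (2 * p)) ->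
  0 < lambda < 1 ->
  Y p alpha u ->
  (\forall z \ae lebesgue_spacetime,
     0 <= heat_power p alpha u z <= u z `^ lambda) ->
  (\forall z \ae lebesgue_spacetime, z.2 < 0 -> u z = 0) ->
  let M := Gamma (alpha * lambda / (1 - lambda) + 1) /
           Gamma (alpha + alpha * lambda / (1 - lambda) + 1) in
  forall T : R, 0 < T ->
    (Lnorm_on +oo [set z | (0 < z.2 < T)%R] u
       <= ((M * T `^ alpha) `^ (1 / (1 - lambda)))%:E)%E /\
    (Lnorm_on +oo [set z | (0 < z.2 < T)%R] (heat_power p alpha u)
       <= ((M * T `^ alpha) `^ (lambda / (1 - lambda)))%:E)%E.
Proof.
move=> _ hp lam01 [f fX fu] fle upast M T T0.
have p1 : 1 <= p by case: hp => [[/ltW]|[->]].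
have a0 : 0 < alpha by case: hp => [[_ /andP[]]|[_ /andP[]]].
have [hX hJ] : X p (heat_power p alpha u) /\ J_eq alpha (heat_power p alpha u) u.
  have : exists f, (X p f /\ J_eq alpha f u) by exists f.
  exact: xgetPex.
have [uB fB] := ae_norm_le_barrier0 p alpha lambda T _ u p1 a0 lam01 T0 hX hJ fle upast.
have BE : barrier alpha lambda 0 T = (M * T `^ alpha) `^ (1 / (1 - lambda)).
  by rewrite barrierE ?addr0.
have -> : lambda / (1 - lambda) = 1 / (1 - lambda) * lambda by rewrite mul1r mulrC.
rewrite (powRrM _ _ lambda) -BE; split; apply: Lnorm_on_pinfty_le => //; last exact: powR_ge0.
by rewrite BE powR_ge0.
Qed.
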